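(* Let $G$ be a weakly relatively hyperbolic group relative to a peripheral structure $\mathcal{P}$ and let $H$ be a relatively quasi-convex subgroup of $G$ which is peripherally finitely generated. Then there exists a finite fragment (finite subgraph) $\Gamma(H,\mathcal{P})$ of the Schreier graph $\mathrm{Schreier}(G,H)$ relative to $A$, with the following property: every element of $H$ admits a representative (a word over $A\cup A^{-1}$) which labels a loop at vertex $H$ in $\Gamma(H,\mathcal{P})$. In particular $H$ is finitely generated.
   Context: $G$ is a group generated by a finite set $A$. A peripheral structure is a finite collection $\mathcal{P}=\{P_1,\dots,P_\ell\}$ of finitely generated subgroups of $G$, called peripheral subgroups. Let $B=\bigcup_{P\in\mathcal{P}}(P\setminus\{1\})$ and let $\mathrm{Cayley}(G,A\cup B)$ be the relative Cayley graph of $G$, where all non-trivial elements of the peripheral subgroups are used as letters as well as the generators in $A$. $G$ is weakly relatively hyperbolic relative to $\mathcal{P}$ if $\mathrm{Cayley}(G,A\cup B)$ is a hyperbolic metric space. Let $\hat F=F(A)*P_1*\dots*P_\ell$. A word on $A\cup A^{-1}\cup B$ is $\hat F$-reduced if it has the form $x_0p_1x_1\cdots p_mx_m$ where the $x_j$ are reduced words in $F(A)$, the $p_j$ are elements of $B$, and $p_j,p_{j+1}$ do not lie in the same $P_i$ if $x_j=1$. It is a relative geodesic if it is geodesic in $\mathrm{Cayley}(G,A\cup B)$. Let $\mathrm{dist}_A(x,y)=|x^{-1}y|_A$ be the distance in $\mathrm{Cayley}(G,A)$. A subset $S\subseteq G$ is relatively quasi-convex if there is a constant $k$ such that, whenever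 an $\hat F$-reduced word labels a relative geodesic path $\pi$ in $\mathrm{Cayley}(G,A\cup B)$ between two elements of $S$, for every vertex $x$ of $\pi$ there is $y\in S$ with $\mathrm{dist}_A(x,y)\le k$. $H\le G$ is peripherally finitely generated if $P\cap H^g$ is finitely generated for every $P\in\mathcal{P}$ and $g\in G$, where $H^g=g^{-1}Hg$. $\mathrm{Schreier}(G,H)$ relative to $A$ has vertices the cosets $Hg$ and edges $(Hg,a,Hga)$ ($g\in G,a\in A$); the letter $a^{-1}$ is read by traversing an $a$-labeled edge backwards. *)

(* Defs.v *)
From mathcomp Require Import all_boot finmap.
From mathcomp Require Import boolp classical_sets cardinality.

Set Implicit Arguments.
Unset Strict Implicit.
Unset Printing Implicit Defensive.

Local Open Scope classical_set_scope.
Local Open Scope group_scope.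

Section CayleyGraph.

(* [L] is an alphabet of letters with values in [G]. It is meant to be
   symmetric (the inverse of a letter's value is the value of a letter), so
   that the edge-paths of the Cayley graph are labelled by words on [L]. *)
Variables (G : groupType) (L : Type) (ev : L -> G).

Definition word_val (w : seq L) : G := \prod_(c <- w) ev c.

(* distance at most [n] between the vertices [x] and [y] *)
Definition dist_le (n : nat) (x y : G) : Prop :=
  exists2 w : seq L, word_val w = x^-1 * y & (size w <= n)%N.

Definition path_vertices (x : G) (w : seq L) : set G :=
  [set x * word_val (take j w) | j in [set j | (j <= size w)%N]].

Definition geodesic_word (w : seq L) : Prop :=
  forall w' : seq L, word_val w' = word_val w -> (size w <= size w')%N.

Definition geodesic_path (x : G) (w : seq L) (y : G) : Prop :=
  x * word_val w = y /\ geodesic_word w.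

(* Slim geodesic triangles. Corners and points of the sides are vertices of
   the graph: passing to its geometric realization only changes [delta]. *)
Definition hyperbolic_cayley : Prop :=
  exists delta : nat, forall (x y z : G) (u v w : seq L),
    geodesic_path x u y -> geodesic_path y v z -> geodesic_path z w x ->
    forall p, path_vertices x u p ->
    exists2 q, (path_vertices y v `|` path_vertices z w) q & dist_le delta p q.

End CayleyGraph.

Section GeneratingSet.

Variables (G : groupType) (A : {fset G}).

(* [(a, false)] is the letter a and [(a, true)] its formal inverse: as in the
   free group F(A), they are distinct even when a is an involution of G. *)
Definition gletter : Type := (A * bool)%type.

Definition gletter_val (c : gletter) : G :=
  if c.2 then (val c.1)^-1 else val c.1.

Definition generated : set G := range (word_val gletter_val).

Definition free_reduced (w : seq gletter) : bool :=
  sorted (fun c d => d != (c.1, ~~ c.2)) w.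

End GeneratingSet.

Definition finitely_generated (G : groupType) (K : set G) : Prop :=
  exists S : {fset G}, generated S = K.

Section Peripheral.

Variables (G : groupType) (A : {fset G}) (l : nat) (P : 'I_l -> groupClosed G).

Definition periph : set G := \bigcup_(i in [set: 'I_l]) ([set` P i] `\ 1).

Definition rletter : Type := (gletter A + periph)%type.

Definition rletter_val (c : rletter) : G :=
  match c with inl a => gletter_val a | inr p => val p end.

Definition weakly_relatively_hyperbolic : Prop := hyperbolic_cayley rletter_val.

Definition same_periph (p q : G) : Prop := exists i, p \in P i /\ q \in P i.

(* x_0 p_1 x_1 ... p_m x_m, with [s] the sequence of the (p_j, x_j) *)
Definition syllables (x0 : seq (gletter A)) (s : seq (periph * seq (gletter A))) :
    seq rletter :=
  [seq inl c | c <- x0] ++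
  flatten [seq inr px.1 :: [seq inl c | c <- px.2] | px <- s].

Definition Fhat_reduced (w : seq rletter) : Prop :=
  exists (x0 : seq (gletter A)) (s : seq (periph * seq (gletter A))),
    [/\ w = syllables x0 s,
        free_reduced x0,
        all (fun px => free_reduced px.2) s &
        forall s1 s2 p x q y, s = s1 ++ (p, x) :: (q, y) :: s2 ->
          x = [::] -> ~ same_periph (val p) (val q)].

Definition relatively_quasiconvex (S : set G) : Prop :=
  exists k : nat, forall (x y : G) (w : seq rletter),
    S x -> S y -> Fhat_reduced w -> geodesic_path rletter_val x w y ->
    forall v, path_vertices rletter_val x w v ->
    exists2 z, S z & dist_le (@gletter_val G A) k v z.

Definition peripherally_finitely_generated (H : groupClosed G) : Prop :=
  forall (i : 'I_l) (g : G),
    finitely_generated ([set` P i] `&` [set h ^ g | h in [set` H]]).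

End Peripheral.

Section Schreier.

Variables (G : groupType) (A : {fset G}) (H : groupClosed G).

Definition rcoset_of (g : G) : set G := [set h * g | h in [set` H]].

Definition schreier_vertices : set (set G) := range rcoset_of.

Definition schreier_edges : set (set G * A * set G) :=
  [set (rcoset_of g, a, rcoset_of (g * val a)) | g in [set: G] & a in [set: A]].

Record schreier_fragment := SchreierFragment {
  fverts : set (set G);
  fedges : set (set G * A * set G);
  fverts_sub : fverts `<=` schreier_vertices;
  fedges_sub : fedges `<=` schreier_edges;
  fedges_ends : forall x a y, fedges (x, a, y) -> fverts x /\ fverts y
}.

Definition finite_fragment (Gamma : schreier_fragment) : Prop :=
  finite_set (fverts Gamma) /\ finite_set (fedges Gamma).

Fixpoint fragment_path (Gamma : schreier_fragment) (x : set G)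
    (w : seq (gletter A)) (y : set G) : Prop :=
  match w with
  | [::] => x = y /\ fverts Gamma x
  | (a, inverse) :: w' => exists z,
      fedges Gamma (if inverse then (z, a, x) else (x, a, z)) /\
      fragment_path Gamma z w' y
  end.

End Schreier.

(* Main.v *)
(* By quasi-convexity, the vertices of a relative geodesic joining 1 to an
   element of H lie in the finitely many cosets H u with |u|_A <= k.  A step
   of the geodesic labelled by a letter of A is an edge of the Schreier graph.
   For a step from H u to H u' labelled by an element of P_i, the possible
   labels form a coset (P_i /\ H^u) p_0; as P_i /\ H^u is finitely generated,
   finitely many loops at H u and one path labelled p_0 represent them all.
   The fragment spanned by these paths works, and it is finite. *)
Require Import Defs.
From mathcomp Require Import all_boot finmap.
From mathcomp Require Import boolp classical_sets cardinality.

Set Implicit Arguments.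
Unset Strict Implicit.
Unset Printing Implicit Defensive.

Local Open Scope classical_set_scope.
Local Open Scope group_scope.

(** * Words, paths and geodesics over an arbitrary alphabet *)

Section Words.

Variables (G : groupType) (L : Type) (ev : L -> G).

Lemma word_val_cons c w : word_val ev (c :: w) = ev c * word_val ev w.
Proof. by rewrite /word_val big_cons. Qed.

Lemma word_val_cat u v : word_val ev (u ++ v) = word_val ev u * word_val ev v.
Proof. by rewrite /word_val big_cat. Qed.

Lemma path_vertices_start x w : path_vertices ev x w x.
Proof. by exists 0%N => //; rewrite take0 /word_val big_nil mulg1. Qed.

Lemma path_vertices_nil x v : path_vertices ev x [::] v -> v = x.
Proof. by case=> j _ <-; rewrite /word_val big_nil mulg1. Qed.

Lemma path_vertices_cons x c w v :
  path_vertices ev x (c :: w) v <-> v = x \/ path_vertices ev (x * ev c) w v.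
Proof.
split=> [[[|j] /= lej <-]|[->|[j lej <-]]].
- by left; rewrite /word_val big_nil mulg1.
- by right; exists j => //; rewrite word_val_cons mulgA.
- exact: path_vertices_start.
- by exists j.+1 => //; rewrite /= word_val_cons mulgA.
Qed.

Lemma path_vertices_cat x u w v :
  path_vertices ev x (u ++ w) v ->
  path_vertices ev x u v \/ path_vertices ev (x * word_val ev u) w v.
Proof.
elim: u x => [|c u IHu] x /=; first by rewrite /word_val big_nil mulg1; right.
move=> /path_vertices_cons[->|/IHu[Hv|]].
- by left; apply: path_vertices_start.
- by left; apply/path_vertices_cons; right.
- by rewrite word_val_cons mulgA; right.
Qed.

Lemma path_vertices_mull h x w v :
  path_vertices ev (h * x) w v ->
  exists2 v', path_vertices ev x w v' & v = h * v'.
Proof.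
case=> j lej <-; exists (x * word_val ev (take j w)); last by rewrite mulgA.
by exists j.
Qed.

Lemma finite_path_vertices x w : finite_set (path_vertices ev x w).
Proof. exact/finite_image/(finite_II (size w).+1). Qed.

Lemma geodesic_word_infix u v w :
  geodesic_word ev (u ++ v ++ w) -> geodesic_word ev v.
Proof.
move=> geo v' eqv; have := geo (u ++ v' ++ w).
rewrite !word_val_cat eqv => /(_ erefl).
by rewrite !size_cat leq_add2l leq_add2r.
Qed.

Lemma geodesic_word_exists w :
  exists2 w', word_val ev w' = word_val ev w & geodesic_word ev w'.
Proof.
pose p n := `[< exists2 w', word_val ev w' = word_val ev w & size w' = n >].
have [|n /asboolP[w' eqw' <-] minw'] := @ex_minnP p.
  by exists (size w); apply/asboolP; exists w.
exists w' => // w2 eqw2; apply/minw'/asboolP; exists w2 => //.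
by rewrite eqw2.
Qed.

End Words.

(** * Subgroups generated by a finite set *)

Section Generated.

Variables (G : groupType) (S : {fset G}).

Lemma generated_closed (K : groupClosed G) :
  (forall s, s \in S -> s \in K) -> generated S `<=` [set` K].
Proof.
move=> SK _ [w _ <-] /=; apply: gpred_prod => -[s b] _.
by case: b; rewrite /gletter_val /= ?gpredV SK ?valP.
Qed.

End Generated.

(** * Reducedness of relative geodesics *)

Section RelativeGeodesics.

Variables (G : groupType) (A : {fset G}) (l : nat) (P : 'I_l -> groupClosed G).

Local Notation rval := (@rletter_val G A l P).

Lemma syllablesP (w : seq (rletter A P)) : exists x0 s, w = syllables x0 s.
Proof.
elim: w => [|[a|p] w [x0 [s ->]]]; first by exists [::], [::].
- by exists (a :: x0), s.
- by exists [::], ((p, x0) :: s).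
Qed.

(** A factor consisting of a letter and its formal inverse has value 1, so deleting it would shorten
    the geodesic. *)
Lemma geodesic_free_reduced (x : seq (gletter A)) :
  geodesic_word rval [seq inl c | c <- x] -> free_reduced x.
Proof.
elim: x => [|c [|d x] IHx] //= geo; apply/andP; split; last first.
  by apply: IHx; apply: (@geodesic_word_infix _ _ _ [:: inl c] _ [::]);
     rewrite cats0.
apply/eqP => dE.
have := @geodesic_word_infix _ _ rval [::] [:: inl c; inl d] _ geo [::].
rewrite /word_val !big_cons big_nil /= dE mulg1.
case: c {IHx geo dE} => a [];
  by rewrite /gletter_val /= ?mulVg ?mulgV => /(_ erefl).
Qed.

(** If both letters lie in one [P i], their product is 1 or a single peripheral letter, hence has
    relative length at most 1. *)
Lemma geodesic_no_same_periph (p q : periph P) :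
  geodesic_word rval [:: inr p; inr q] -> ~ same_periph P (val p) (val q).
Proof.
move=> geo [i [pi qi]]; have [pq1|/eqP pqN1] := eqVneq (val p * val q) 1.
  have := geo [::]; rewrite /word_val !big_cons big_nil /= mulg1 pq1.
  by move=> /(_ erefl).
have pqB : periph P (val p * val q) by exists i => //; split => //=; apply: gpredM.
have := geo [:: inr (exist (fun x => x \in periph P) _ (mem_set pqB))].
by rewrite /word_val !big_cons big_nil /= !mulg1 => /(_ erefl).
Qed.

(** Quasi-convexity constrains only geodesics with reduced labels; this makes it applicable to every
    relative geodesic. *)
Lemma geodesic_Fhat_reduced (w : seq (rletter A P)) :
  geodesic_word rval w -> Fhat_reduced w.
Proof.
case: (syllablesP w) => x0 [s ->] geo; exists x0, s.
split=> // [||s1 s2 p x q y sE xE].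
- by apply/geodesic_free_reduced/(@geodesic_word_infix _ _ _ [::])/geo.
(* Dropping [x0] leaves a geodesic whose shape is stable under induction on the syllables. *)
- have {geo} : geodesic_word rval (syllables [::] s).
    by apply: (@geodesic_word_infix _ _ _ _ _ [::]); rewrite cats0; exact: geo.
  rewrite /syllables /=; elim: s => //= -[p x] s IHs geo; apply/andP; split.
    by apply/geodesic_free_reduced/(@geodesic_word_infix _ _ _ [:: inr p])/geo.
  apply: IHs.
  apply: (@geodesic_word_infix _ _ _ (inr p :: [seq inl c | c <- x]) _ [::]).
  by rewrite cats0.
- apply: geodesic_no_same_periph; move: geo; rewrite sE xE /syllables.
  rewrite map_cat flatten_cat /= catA.
  by move=> /(@geodesic_word_infix _ _ _ _ [:: inr p; inr q]).
Qed.

End RelativeGeodesics.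

(** * Cosets and finite generation from a finite fragment *)

Section Schreier.

Variables (G : groupType) (A : {fset G}) (H : groupClosed G).

Local Notation rc := (rcoset_of H).
Local Notation aval := (@gletter_val G A).

Lemma rcoset_of1 : rc 1 = [set` H].
Proof.
apply/seteqP; split=> [_ [h Hh <-]|h Hh]; first by rewrite mulg1.
by exists h => //; rewrite mulg1.
Qed.

Lemma rcoset_of_mull h g : h \in H -> rc (h * g) = rc g.
Proof.
move=> Hh; apply/seteqP; split=> _ [k /= Hk <-].
  by exists (k * h); [apply: gpredM | rewrite mulgA].
by exists (k / h); [apply: gpredF | rewrite mulgA mulgVK].
Qed.

(** Schreier's method: with a representative [t x] of each coset, the elements [t x * a / t y], one
    for each edge of the fragment, lie in [H], and the value of a loop at [H] telescopes into a
    product of them and their inverses. *)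
Lemma fragment_finitely_generated (Gamma : schreier_fragment A H) :
  finite_fragment Gamma ->
  (forall h, h \in H -> exists w : seq (gletter A),
     word_val aval w = h /\ fragment_path Gamma [set` H] w [set` H]) ->
  finitely_generated [set` H].
Proof.
move=> [_ finE] loops.
(* The value 1 at [H] itself makes both end factors vanish for loops at [H]. Cosets are nonempty, so
   the default of [xget] is never taken on them. *)
pose t (x : set G) : G := if `[< x = [set` H] >] then 1 else xget 1 x.
have tH : t [set` H] = 1 by rewrite /t; case: asboolP.
have tP g : exists2 h, h \in H & t (rc g) = h * g.
  suff : rc g (t (rc g)) by case=> h Hh <-; exists h.
  rewrite /t; case: asboolP => [->|_]; first exact: gpred1.
  by apply: (@xgetPex _ 1 (rc g)); exists (1 * g), 1 => //; apply: gpred1.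
pose gen (e : set G * A * set G) := t e.1.1 * val e.1.2 / t e.2.
pose S := fset_set (gen @` fedges Gamma).
have memS s : (s \in S) = (s \in gen @` fedges Gamma).
  by rewrite in_fset_set //; apply: finite_image.
exists S; apply/seteqP; split.
  apply: generated_closed => s; rewrite memS inE => -[e /fedges_sub].
  case=> g _ [a _ <-] <-; rewrite /gen /=.
  have [h Hh ->] := tP g; have [k Hk ->] := tP (g * val a).
  by rewrite -(mulgA h) mulgKA gpredF.
(* Induction on the word forces arbitrary end vertices; loops are the case where both are [H]. *)
suff pathP w x y : fragment_path Gamma x w y ->
    generated S (t x * word_val aval w / t y).
  by move=> h /loops[w [<- /pathP]]; rewrite tH mul1g divg1.
elim: w x => [|[a b] w IHw] x /=.
  by case=> -> _; exists [::] => //; rewrite /word_val !big_nil mulg1 mulgV.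
case=> z [Ee /IHw [u _ uE]].
have eS : gen (if b then (z, a, x) else (x, a, z)) \in S.
  by rewrite memS; apply/mem_set; exists (if b then (z, a, x) else (x, a, z)).
(* An edge traversed backwards contributes the inverse of its generator, hence the same flag [b]. *)
exists (([` eS]%fset, b) :: u) => //; rewrite !word_val_cons uE /gletter_val /=.
rewrite mulgA; congr (_ / _); rewrite !mulgA; congr (_ * _).
by case: b {Ee eS}; rewrite /gen /= ?invgM ?invgK ?mulgA mulgVK.
Qed.

(** * Full subgraphs of the Schreier graph and lifted paths *)

Section Induced.

Variable V : set (set G).

Let E : set (set G * A * set G) :=
  schreier_edges H `&` [set e | V e.1.1 /\ V e.2].

Let V_sub : V `&` schreier_vertices H `<=` schreier_vertices H.
Proof. by move=> x []. Qed.

Let E_sub : E `<=` schreier_edges H.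
Proof. by move=> x []. Qed.

Let E_ends x a y :
  E (x, a, y) -> (V `&` schreier_vertices H) x /\ (V `&` schreier_vertices H) y.
Proof. by case=> -[g _ [b _ [<- _ <-]]] [/= Vx Vy]; split; split => //; eexists. Qed.

(** [V] may contain sets that are not cosets, hence the intersection with the Schreier vertices. *)
Definition induced_fragment := SchreierFragment V_sub E_sub E_ends.

Lemma finite_induced_fragment : finite_set V -> finite_fragment induced_fragment.
Proof.
move=> finV; split; first exact: finite_setIl.
apply: (@sub_finite_set _ _ (V `*` [set: A] `*` V)).
  by move=> e [_ [Vx Vy]]; split.
by apply: finite_setX => //; apply: finite_setX => //; apply: finite_finset.
Qed.

(** The endpoints are group elements, not cosets: a path inside [V] is recorded by a lift to the
    Cayley graph, which fixes the value of its label. *)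
Definition connects_in (x y : G) : Prop :=
  exists2 w : seq (gletter A), x * word_val aval w = y &
    forall v, path_vertices aval x w v -> V (rc v).

Lemma connects_in_trans x y z :
  connects_in x y -> connects_in y z -> connects_in x z.
Proof.
move=> [u <- Vu] [w <- Vw]; exists (u ++ w); first by rewrite word_val_cat mulgA.
by move=> v /path_vertices_cat[/Vu|/Vw].
Qed.

(** Left translation by [H] preserves labels and right cosets, so a pair need only be treated up to
    this action. *)
Lemma connects_in_mull h x y :
  h \in H -> connects_in x y -> connects_in (h * x) (h * y).
Proof.
move=> Hh [w <- Vw]; exists w; first by rewrite mulgA.
by move=> v /path_vertices_mull[v' /Vw Vv' ->]; rewrite rcoset_of_mull.
Qed.

Lemma connects_in_fragment_path x y : connects_in x y ->
  exists2 w, x * word_val aval w = y & fragment_path induced_fragment (rc x) w (rc y).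
Proof.
move=> [w <- Vw]; exists w => //; elim: w x Vw => [|[a b] w IHw] x Vw /=.
  rewrite /word_val big_nil mulg1; split=> //; split; last by exists x.
  by apply: Vw; apply: path_vertices_start.
have Vx : V (rc x) by apply: Vw; apply: path_vertices_start.
have Vz v : path_vertices aval (x * aval (a, b)) w v -> V (rc v).
  by move=> Hv; apply: Vw; apply/path_vertices_cons; right.
exists (rc (x * aval (a, b))); split; last first.
  by rewrite word_val_cons mulgA; apply: IHw.
have {}Vz := Vz _ (path_vertices_start _ _ _).
case: b Vz {Vw}; rewrite /gletter_val /= => Vz; split => //.
  by exists (x / val a) => //; exists a => //; rewrite mulgVK.
by exists x => //; exists a.
Qed.

End Induced.

(** * Families of pairs joined inside one finite vertex set *)

Lemma connects_in_sub (V W : set (set G)) x y :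
  V `<=` W -> connects_in V x y -> connects_in W x y.
Proof. by move=> VW [w wE Vw]; exists w => // v /Vw /VW. Qed.

(** One finite [V] has to serve all pairs of [R], which may be infinite in number. *)
Definition finitely_connected (R : set (G * G)) : Prop :=
  exists2 V : set (set G), finite_set V & forall e, R e -> connects_in V e.1 e.2.

Lemma finitely_connected_sub R R' :
  R `<=` R' -> finitely_connected R' -> finitely_connected R.
Proof. by move=> sub [V finV VP]; exists V => // e /sub /VP. Qed.

Lemma finitely_connected_bigcup (I : Type) (D : set I) (R : I -> set (G * G)) :
  finite_set D -> (forall i, D i -> finitely_connected (R i)) ->
  finitely_connected (\bigcup_(i in D) R i).
Proof.
move=> finD finR.
have /choice[V VP] i : exists V, D i ->
    finite_set V /\ forall e, R i e -> connects_in V e.1 e.2.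
  have [/finR[V finV VP]|nDi] := pselect (D i); first by exists V.
  by exists set0.
exists (\bigcup_(i in D) V i); first by apply: bigcup_finite => // i /VP[].
by move=> e [i Di /(VP i Di).2]; apply: connects_in_sub; apply: bigcup_sup.
Qed.

Lemma finitely_connectedU R R' :
  finitely_connected R -> finitely_connected R' -> finitely_connected (R `|` R').
Proof.
move=> [V finV VP] [W finW WP]; exists (V `|` W); first by rewrite finite_setU.
move=> e [/VP|/WP]; apply: connects_in_sub; first exact: subsetUl.
exact: subsetUr.
Qed.

Lemma finitely_connected1 e : generated A = [set: G] -> finitely_connected [set e].
Proof.
move=> A_gen; have [w _ wE] : generated A (e.1^-1 * e.2) by rewrite A_gen.
exists (rc @` path_vertices aval e.1 w).
  exact/finite_image/finite_path_vertices.
move=> _ ->; exists w; first by rewrite wE mulVKg.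
by move=> v Hv; exists v.
Qed.

(* A subgroup of the stabilizer [H ^ u] of the vertex [H u] acts by loops at
   [H u], and loops for its generators can be concatenated. *)
Lemma finitely_connected_conj (K : set G) u :
  generated A = [set: G] -> finitely_generated K ->
  (forall q, K q -> u * q / u \in H) ->
  finitely_connected [set (u, u * q) | q in K].
Proof.
move=> A_gen [S <-] HK.
have [V finV VP] : finitely_connected ([set (u, u)] `|`
    \bigcup_(c in [set: gletter S]) [set (u, u * gletter_val c)]).
  apply: finitely_connectedU; first exact: finitely_connected1.
  by apply: finitely_connected_bigcup => [|c _];
     [exact: finite_finset | exact: finitely_connected1].
exists V => // _ [_ [w _ <-] <-] /=; elim: w => [|c w IHw].
  by rewrite /word_val big_nil mulg1; apply: (VP (u, u)); left.
rewrite word_val_cons mulgA; apply: connects_in_trans.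
  by apply: (VP (u, u * gletter_val c)); right; exists c.
have {IHw} := @connects_in_mull V (u * gletter_val c / u) _ _ _ IHw.
rewrite mulgA !mulgVK; apply; apply: HK.
by exists [:: c] => //; rewrite /word_val big_seq1.
Qed.

(** * Replacing relative paths by words over the generators *)

Section QuasiconvexSteps.

Variables (l : nat) (P : 'I_l -> groupClosed G).
Hypothesis A_gen : generated A = [set: G].
Hypothesis H_pfg : peripherally_finitely_generated P H.

Local Notation rval := (@rletter_val G A l P).

(** Fix one admissible label [p0]. Any other factors as [p = q * p0] with [q] in [P i] and in
    [H ^ u]: a loop at [H u] reading [q], then a fixed path reading [p0]. *)
Lemma finitely_connected_periph i u u' :
  finitely_connected [set (u, u * p) | p in [set p | p \in P i /\ u * p / u' \in H]].
Proof.
have [[p0 [Pp0 Hp0]]|noP] := pselect (exists p, p \in P i /\ u * p / u' \in H);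
  last by exists set0 => // e [p Pp _]; case: noP; exists p.
have KH q : ([set` P i] `&` [set h ^ u | h in [set` H]]) q -> u * q / u \in H.
  by case=> _ [h Hh <-]; rewrite /conjg mulVKg mulgK.
have [V finV VP] := finitely_connectedU
  (finitely_connected_conj A_gen (@H_pfg i u) KH)
  (finitely_connected1 (u, u * p0) A_gen).
exists V => // _ [p [Pp Hp] <-] /=; set q := p / p0.
have Hq : u * q / u \in H.
  have -> : u * q / u = (u * p / u') / (u * p0 / u').
    by rewrite mulgKA invgM !mulgA.
  exact: gpredF.
apply: (@connects_in_trans _ _ (u * q)).
  apply: (VP (u, u * q)); left; exists q => //; split; first exact: gpredF.
  by exists (u * q / u) => //; rewrite /conjg mulgVK mulKg.
(* Translation by [u * q / u], an element of [H], moves the path from [u] to [u * p0] onto one from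
   [u * q] to [u * p]. *)
have := connects_in_mull Hq (VP (u, u * p0) (or_intror erefl)).
by rewrite /= mulgVK (mulgA (u * q / u)) mulgVK -(mulgA u q) mulgVK.
Qed.

(** Letters of [A] give finitely many pairs; peripheral letters give one family for each of the
    finitely many triples [i], [u], [u']. *)
Lemma finitely_connected_steps (N : set G) : finite_set N ->
  finitely_connected [set e | N e.1 /\
    exists (c : rletter A P) u', [/\ N u', e.2 = e.1 * rval c & e.2 / u' \in H]].
Proof.
move=> finN; pose R_A u := \bigcup_(c in [set: gletter A]) [set (u, u * aval c)].
pose R_P i u u' := [set (u, u * p) | p in [set p | p \in P i /\ u * p / u' \in H]].
apply: (@finitely_connected_sub _ ((\bigcup_(u in N) R_A u) `|`
    \bigcup_(i in [set: 'I_l]) \bigcup_(u in N) \bigcup_(u' in N) R_P i u u')).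
  case=> u v /= [Nu [c [u' [Nu' -> Hu']]]].
  case: c Hu' => [c|[p pB]] /= Hu'; first by left; exists u => //; exists c.
  have [i _ [/= Pp _]] := set_mem pB.
  by right; exists i => //; exists u => //; exists u' => //; exists p.
apply: finitely_connectedU.
  apply: finitely_connected_bigcup => // u _.
  by apply: finitely_connected_bigcup => [|c _];
     [exact: finite_finset | exact: finitely_connected1].
apply: finitely_connected_bigcup => [|i _]; first exact: finite_finset.
apply: finitely_connected_bigcup => // u _.
apply: finitely_connected_bigcup => // u' _.
exact: finitely_connected_periph.
Qed.

(** Each step of the path is translated by an element of [H] so as to start in [N], where only the
    steps already treated occur; the replacements are then translated back and concatenated. *)
Lemma finitely_connected_near (N : set G) : finite_set N ->
  let near v := exists2 u, N u & v / u \in H in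
  finitely_connected [set e | exists2 w : seq (rletter A P),
    e.1 * word_val rval w = e.2 & path_vertices rval e.1 w `<=` near].
Proof.
move=> finN near.
(* The pairs [(u, u)] serve the empty word, whose only vertex must also have its coset in [V]. *)
have [V finV VP] := finitely_connectedU (finitely_connected_steps finN)
  (finitely_connected_bigcup finN (fun u _ => finitely_connected1 (u, u) A_gen)).
exists V => // -[x y] /= [w <-]; elim: w x => [|c w IHw] x nearP.
  have [u Nu Hu] := nearP x (path_vertices_start _ _ _).
  have /(connects_in_mull Hu) : connects_in V u u.
    by apply: (VP (u, u)); right; exists u.
  by rewrite mulgVK /word_val big_nil mulg1.
have [u Nu Hu] := nearP x (path_vertices_start _ _ _).
have nearc : path_vertices rval (x * rval c) w `<=` near.
  by move=> v vP; apply: nearP; apply/path_vertices_cons; right.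
rewrite word_val_cons mulgA; apply: connects_in_trans (IHw _ nearc).
have [u' Nu' Hu'] := nearc _ (path_vertices_start _ _ _).
have /(connects_in_mull Hu) : connects_in V u (u * rval c).
  apply: (VP (u, u * rval c)); left; split=> //; exists c, u'; split=> //=.
  have -> : u * rval c / u' = (x / u)^-1 * (x * rval c / u').
    by rewrite invgF !mulgA mulgVK.
  by rewrite gpredM // gpredV.
by rewrite mulgA mulgVK.
Qed.

End QuasiconvexSteps.

End Schreier.

(** * The fragment obtained from the quasi-convexity constant *)

Theorem proposition7p2 (G : groupType) (A : {fset G})
    (A_gen : generated A = [set: G])
    (l : nat) (P : 'I_l -> groupClosed G)
    (P_fg : forall i, finitely_generated [set` P i])
    (G_hyp : weakly_relatively_hyperbolic A P)
    (H : groupClosed G)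
    (H_qc : relatively_quasiconvex A P [set` H])
    (H_pfg : peripherally_finitely_generated P H) :
  (exists Gamma : schreier_fragment A H,
     finite_fragment Gamma /\
     forall h, h \in H ->
       exists w : seq (gletter A),
         word_val (@gletter_val G A) w = h /\
         fragment_path Gamma [set` H] w [set` H]) /\
  finitely_generated [set` H].
Proof.
suff [Gamma [finG loops]] : exists Gamma : schreier_fragment A H,
    finite_fragment Gamma /\ forall h, h \in H ->
      exists w : seq (gletter A), word_val (@gletter_val G A) w = h /\
        fragment_path Gamma [set` H] w [set` H].
  split; first by exists Gamma.
  exact: fragment_finitely_generated finG loops.
have [k kP] := H_qc.
(* If [b] leads from a vertex [v] to [z] in [H], then [v] lies in the coset of the inverse of [b];
   words of length at most [k] form a finite type. *)
pose N := range (fun b : k.-bseq (gletter A) => (word_val (@gletter_val G A) b)^-1).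
have finN : finite_set N by apply: finite_image; apply: finite_finset.
have [V finV VP] := finitely_connected_near A_gen H_pfg finN.
exists (induced_fragment A H V); split; first exact: finite_induced_fragment.
move=> h Hh.
have [w0 _ w0E] : generated A h by rewrite A_gen.
(* A word over [A] with value [h] is also a word on the relative alphabet, so a relative geodesic
   from 1 to [h] exists. *)
have [w wE geo] := geodesic_word_exists (@rletter_val G A l P) [seq inl c | c <- w0].
have {}wE : word_val (@rletter_val G A l P) w = h.
  by rewrite wE -w0E /word_val big_map.
have near v : path_vertices (@rletter_val G A l P) 1 w v ->
    exists2 u, N u & v / u \in H.
  move=> vP; have [||z Hz [b bE bk]] := kP 1 h w _ Hh
    (geodesic_Fhat_reduced geo) _ v vP; first exact: gpred1.
    by split=> //; rewrite mul1g.
  exists (word_val (@gletter_val G A) b)^-1; first by exists (Bseq bk).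
  by rewrite invgK bE mulVKg.
have [|u uE pathu] := connects_in_fragment_path (VP (1, h) _).
  by exists w; rewrite /= ?mul1g.
exists u; split; first by rewrite mul1g in uE.
(* The path ends at the coset of [h], which is [H] because [h] lies in [H]: it is a loop. *)
by move: pathu; rewrite /= -(mulg1 h) rcoset_of_mull // rcoset_of1.
Qed.
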